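(* Let $Q$ be a quiver with vertices $1,\dots,p$. (a) Let $A$ be a unitary representation of $Q$ with $A\not\simeq_{\mathbb C}\bar A$. Then $A$ is not isometric to a Euclidean representation. (b) Let $A$ be an indecomposable unitary representation of $Q$ and let $S=(S_1,\dots,S_p):A\to\bar A$ be an isometry. (i) If $S=S^T$, then $A$ is isometric to a Euclidean representation $B$ given by the isometry $U=(U_1,\dots,U_p):A\to B$, where $U_1,\dots,U_p$ are arbitrary unitary matrices such that $U_i^TU_i=S_i$ for all $i$ (such matrices exist). (ii) If $S\ne S^T$, then $S=-S^T$ and $A$ is not isometric to a Euclidean representation, but $A$ is isometric to a unitary representation $C$ all of whose matrices have the block form $$C_\alpha=\begin{bmatrix}X_\alpha&Y_\alpha\\-\bar Y_\alpha&\bar X_\alpha\end{bmatrix},$$ given by the isometry $V=(V_1,\dots,V_p):A\to C$, where $V_1,\dots,V_p$ are arbitrary unitary matrices such that $V_i^T\begin{bmatrix}0&I\\-I&0\end{bmatrix}V_i=S_i$ for all $i$ (such matrices exist).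
   Context: A quiver is a finite directed graph. A unitary representation of $Q$ of dimension $d=(d_1,\dots,d_p)\in\mathbb N_0^p$ assigns to each arrow $\alpha:i\to j$ a matrix $A_\alpha\in\mathbb C^{d_j\times d_i}$; it is a Euclidean representation if all $A_\alpha$ are real. An isometry $S:A\to B$ of unitary representations of the same dimension $d$ is a sequence $S=(S_1,\dots,S_p)$ of unitary $d_i\times d_i$ matrices with $S_jA_\alpha=B_\alpha S_i$ for each arrow $\alpha:i\to j$; if one exists, $A$ and $B$ are isometric, $A\simeq_{\mathbb C}B$. Given $A$ and a sequence $U$ of unitary matrices, the representation $B$ ''given by the isometry $U:A\to B$'' has matrices $B_\alpha=U_jA_\alpha U_i^{-1}$. Direct sums are taken arrow by arrow (with $M\oplus 0_{0n}$, $M\oplus0_{m0}$ meaning adding $n$ zero columns, $m$ zero rows). A unitary representation $A$ of dimension $d$ is indecomposable if $d\ne0$ and $A\simeq_{\mathbb C}B\oplus C$ implies that $B$ or $C$ has dimension $0$. $\bar A$ is obtained by replacing all matrices by their complex conjugates; $S^T=(S_1^T,\dots,S_p^T)$ and $-S^T=(-S_1^T,\dots,-S_p^T)$. In (ii) each $d_i$ is even, the block $I$ at vertex $i$ has size $d_i/2$, and each $C_\alpha$ ($\alpha:i\to j$) is divided into four $\frac{d_j}2\times\frac{d_i}2$ blocks. *)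

(* Defs.v *)
From mathcomp Require Import all_boot all_order all_algebra.
From mathcomp Require Import spectral.
From mathcomp Require Import complex.
From mathcomp Require Import reals.

Set Implicit Arguments.
Unset Strict Implicit.
Unset Printing Implicit Defensive.

Import Order.TTheory GRing.Theory Num.Theory.
Local Open Scope ring_scope.

(* Loops and multiple arrows are allowed. *)
Record quiver (p : nat) := Quiver {
  arrow : finType;
  source : arrow -> 'I_p;
  target : arrow -> 'I_p }.

Definition urep (C : numClosedFieldType) p (Q : quiver p) (d : 'I_p -> nat) :=
  forall a : arrow Q, 'M[C]_(d (target a), d (source a)).

Section UnitaryRepresentations.
Variables (C : numClosedFieldType) (p : nat) (Q : quiver p).
Implicit Types d : 'I_p -> nat.

Definition euclidean d (A : urep C Q d) : Prop :=
  forall a, A a \is a mxOver Num.real.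

(* The dimensions of [A] and [B] are only required to be pointwise equal, which
   avoids casts when [B] is a direct sum.  Since they are equal, every [S i] is
   a square matrix, and [unitarymx] (S i times its adjoint is 1) is the usual
   unitarity. *)
Definition urep_isometry d d' (A : urep C Q d) (B : urep C Q d')
    (S : forall i, 'M[C]_(d' i, d i)) : Prop :=
  [/\ forall i, d i = d' i,
      forall i, S i \is unitarymx
    & forall a, S (target a) *m A a = B a *m S (source a)].

Definition urep_isometric d d' (A : urep C Q d) (B : urep C Q d') : Prop :=
  exists S, urep_isometry A B S.

Definition isometric_to_euclidean d (A : urep C Q d) : Prop :=
  exists B : urep C Q d, euclidean B /\ urep_isometric A B.

Definition conj_urep d (A : urep C Q d) : urep C Q d :=
  fun a => map_mx Num.conj (A a).

Definition transport d (U : forall i, 'M[C]_(d i)) (A : urep C Q d) :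
    urep C Q d :=
  fun a => U (target a) *m A a *m invmx (U (source a)).

Definition dsum_urep d1 d2 (A : urep C Q d1) (B : urep C Q d2) :
    urep C Q (fun i => d1 i + d2 i)%N :=
  fun a => block_mx (A a) 0 0 (B a).

Definition indecomposable d (A : urep C Q d) : Prop :=
  ~ (forall i, d i = 0%N) /\
  forall d1 d2 (A1 : urep C Q d1) (A2 : urep C Q d2),
    urep_isometric A (dsum_urep A1 A2) ->
    (forall i, d1 i = 0%N) \/ (forall i, d2 i = 0%N).

End UnitaryRepresentations.

Lemma halves_even n : ~~ odd n -> (n./2 + n./2)%N = n.
Proof. by move=> n_even; rewrite addnn even_halfK. Qed.

Definition sympl_mx (C : numClosedFieldType) n (n_even : ~~ odd n) : 'M[C]_n :=
  castmx (halves_even n_even, halves_even n_even)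
    (block_mx 0 1%:M (- 1%:M) 0).

Definition quaternionic_mx (C : numClosedFieldType) m n
    (m_even : ~~ odd m) (n_even : ~~ odd n) (M : 'M[C]_(m, n)) : Prop :=
  exists X Y : 'M[C]_(m./2, n./2),
    M = castmx (halves_even m_even, halves_even n_even)
          (block_mx X Y (- map_mx Num.conj Y) (map_mx Num.conj X)).

(* Main.v *)
(* Composing an isometry S : A -> conj A with its conjugate gives an
   endomorphism of A.  A normal endomorphism of an indecomposable A is scalar:
   all its matrices are unitarily diagonalizable, and splitting off one
   eigenvalue at every vertex decomposes A.  Applied to S^T and S, this gives
   S = l S^T with l^2 = 1.  A Euclidean form W : A -> B makes W^T W a symmetric
   isometry A -> conj A, and S is a scalar multiple of it, so S is symmetric.
   Conversely, if S = U^T J U with U unitary, then conj(U) S = J U, so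
   C := U A U^-1 satisfies conj(C) J = J C: C is real for J = 1, and
   quaternionic for J symplectic. *)

Require Import Defs.
From mathcomp Require Import all_boot all_order all_algebra.
From mathcomp Require Import spectral complex reals.

Local Open Scope ring_scope.

Set Implicit Arguments.
Unset Strict Implicit.
Unset Printing Implicit Defensive.
Import Order.TTheory GRing.Theory Num.Theory.
Local Open Scope sesquilinear_scope.

(** * Unitary congruence of symmetric and skew-symmetric unitary matrices *)

Section UnitaryMatrices.
Variable C : numClosedFieldType.

(** The equation [m = n] is a hypothesis because the matrices that split a representation have sizes
    [d i] and [#|E i| + #|~: E i|], equal only propositionally. *)
Lemma unitarymx_adjK m n (S : 'M[C]_(m, n)) :
  m = n -> S \is unitarymx -> S^t* *m S = 1%:M.
Proof. by move=> mn S_unitary; rewrite -[_^t*]mul1mx mulmxKtV. Qed.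

Lemma unitarymx_normal n (S : 'M[C]_n) : S \is unitarymx -> S \is normalmx.
Proof.
by move=> Su; apply/normalmxP; rewrite unitarymx_adjK // (unitarymxP _).
Qed.

(** Entry (i, j) reads (d_i - e_j) W_ij = 0. This serves both to pass from D to sqrt(D) and to
    separate eigenspaces. *)
Lemma diag_mx_intertwine m n (d : 'rV[C]_m) (e : 'rV[C]_n) (W : 'M_(m, n)) :
  diag_mx d *m W = W *m diag_mx e ->
  forall i j, d 0 i != e 0 j -> W i j = 0.
Proof.
rewrite mul_diag_mx mul_mx_diag => /matrixP eqW i j neq.
have /eqP := eqW i j; rewrite !mxE mulrC -subr_eq0 -mulrBr mulf_eq0.
by rewrite subr_eq0 (negPf neq) orbF => /eqP.
Qed.

Lemma mxsub_mul m n p q r (f : 'I_q -> 'I_m) (g : 'I_r -> 'I_p)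
    (M : 'M[C]_(m, n)) (N : 'M_(n, p)) :
  rowsub f M *m colsub g N = mxsub f g (M *m N).
Proof.
by apply/matrixP => i j; rewrite !mxE; apply: eq_bigr => k _; rewrite !mxE.
Qed.

Lemma adj_rowsub m n q (f : 'I_q -> 'I_m) (M : 'M[C]_(m, n)) :
  (rowsub f M)^t* = colsub f (M^t*).
Proof. by apply/matrixP => i j; rewrite !mxE. Qed.

Lemma mxsub1_inj n q (f : 'I_q -> 'I_n) :
  injective f -> mxsub f f (1%:M : 'M[C]_n) = 1%:M.
Proof. by move=> fI; apply/matrixP => i j; rewrite !mxE (inj_eq fI). Qed.

(* With S = P^-1 D P, the matrix U := P^-1 sqrt(D) P is symmetric because P P^T
   commutes with D, hence with sqrt(D); so U^T U = U^2 = S. *)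
Lemma takagi_unitary n (S : 'M[C]_n) : S \is unitarymx -> S = S^T ->
  exists U : 'M[C]_n, U \is unitarymx /\ U^T *m U = S.
Proof.
move=> Su Ssym; have /orthomx_spectralP := unitarymx_normal Su.
set P := spectralmx S; set D := spectral_diag S => S_eq.
have Pu : P \is unitarymx by apply: spectral_unitarymx.
have PU := unitarymx_unit Pu; have PTU : P^T \in unitmx by rewrite unitmx_tr.
have iPu : invmx P \is unitarymx by rewrite invmx_unitary ?trmxC_unitary.
have D_eq : diag_mx D = P *m S *m invmx P by rewrite S_eq !mulmxA mulmxV ?mul1mx ?mulmxK.
pose E := map_mx sqrtC D.
have EE : diag_mx E *m diag_mx E = diag_mx D.
  rewrite mulmx_diag; congr diag_mx; apply/rowP => j.
  by rewrite !mxE -expr2 sqrtCK.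
(* Unitarity of [S] makes the entries of [D] unimodular, hence also their square roots. *)
have Eu : diag_mx E \is unitarymx.
  have /unitarymxP : diag_mx D \is unitarymx.
    by rewrite D_eq !mul_unitarymx.
  rewrite tr_diag_mx map_diag_mx mulmx_diag => /matrixP DD.
  apply/unitarymxP; rewrite tr_diag_mx map_diag_mx mulmx_diag.
  apply/matrixP => i j; have := DD i j; rewrite !mxE.
  have [_|//] := eqVneq i j; rewrite !mulr1n -!normCK => /eqP.
  rewrite sqrp_eq1 // => /eqP <-.
  by rewrite -{2}[D 0 i]sqrtCK normrX.
(* Substitute S = P^-1 D P in P S P^T = P S^T P^T. *)
have DW : diag_mx D *m (P *m P^T) = (P *m P^T) *m diag_mx D.
  have : P *m S *m P^T = P *m S^T *m P^T by rewrite -Ssym.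
  rewrite S_eq !trmx_mul tr_diag_mx trmx_inv !mulmxA mulmxV // mul1mx => ->.
  by rewrite mulmxKV.
have EW : diag_mx E *m (P *m P^T) = (P *m P^T) *m diag_mx E.
  rewrite mul_diag_mx mul_mx_diag; apply/matrixP => i j; rewrite !mxE.
  have [->|neq] := eqVneq (D 0 i) (D 0 j); first by rewrite mulrC.
  have := diag_mx_intertwine DW neq; rewrite !mxE => ->.
  by rewrite mulr0 mul0r.
pose U := invmx P *m diag_mx E *m P.
exists U; split; first by rewrite !mul_unitarymx.
have -> : U^T = U.
  have PTE : P^T *m diag_mx E = invmx P *m (diag_mx E *m (P *m P^T)).
    by rewrite EW -mulmxA mulKmx.
  by rewrite !trmx_mul tr_diag_mx trmx_inv mulmxA PTE !mulmxA mulmxK.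
by rewrite /U !mulmxA mulmxK // -[_ *m _ *m diag_mx E]mulmxA EE [RHS]S_eq.
Qed.

(** Orthogonality and S-orthogonality to the rows of [Z] are 2m linear conditions, collected in [K],
    on n > 2m unknowns; a nonzero solution is then normalized. *)
Lemma skew_isotropic_row m n (S : 'M[C]_n) (Z : 'M[C]_(m, n)) :
  (m.*2 < n)%N -> S = - S^T ->
  exists z : 'rV[C]_n, [/\ z *m z^t* = 1%:M, z *m Z^t* = 0, z *m S *m Z^T = 0
    & z *m S *m z^T = 0].
Proof.
move=> ltmn Sskew; pose K := row_mx (Z^t*) (S *m Z^T).
have /rowV0Pn[y yK y_neq0] : kermx K != 0.
  rewrite kermx_eq0 /row_free neq_ltn; apply/orP; left.
  by rewrite (leq_ltn_trans (rank_leq_col _)) // addnn.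
pose z := schmidt y.
have z_unit : z *m z^t* = 1%:M.
  by apply/unitarymxP/schmidt_unitarymx; rewrite (leq_ltn_trans _ ltmn).
have zK : z *m K = 0.
  apply/sub_kermxP; rewrite eqmx_schmidt_free ?yK //.
  by rewrite /row_free rank_rV y_neq0.
have /eq_row_mx[zZ zSZ] : row_mx (z *m Z^t*) (z *m (S *m Z^T)) = row_mx 0 0.
  by rewrite -mul_mx_row row_mx0.
exists z; split=> //; first by rewrite -mulmxA.
(* A 1 x 1 matrix is its own transpose, while skewness of [S] makes that transpose -q. *)
set q := z *m S *m z^T; have qT : q^T = q by rewrite [q]mx11_scalar tr_scalar_mx.
have qN : q = - q.
  by rewrite -{2}qT !trmx_mul trmxK mulmxA -mulNmx -mulmxN -Sskew.
apply/matrixP => i j; have /matrixP/(_ i j)/eqP := qN.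
by rewrite !mxE -addr_eq0 -mulr2n mulrn_eq0 => /eqP.
Qed.

(** Isotropic orthonormal rows are adjoined one at a time. For invertible [S] and n = 2m they span a
    Lagrangian subspace. *)
Lemma skew_lagrangian n (S : 'M[C]_n) m :
  (m.*2 <= n)%N -> S = - S^T ->
  exists Z : 'M[C]_(m, n), Z \is unitarymx /\ Z *m S *m Z^T = 0.
Proof.
move=> + Sskew; elim: m => [|m IHm] mn.
  by exists 0; split; [apply/unitarymxP | ]; rewrite [LHS]flatmx0 ?[RHS]flatmx0.
have [|Z [/unitarymxP Zu ZS]] := IHm; first by rewrite (leq_trans _ mn) // leq_double.
have [|z [zz zZ zSZ zSz]] := @skew_isotropic_row m n S Z _ Sskew.
  by rewrite (leq_trans _ mn).
rewrite -addn1; exists (col_mx Z z); split.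
  apply/unitarymxP; rewrite tr_col_mx map_row_mx mul_col_row Zu zz zZ.
  have -> : Z *m z^t* = 0.
    by rewrite -[LHS]trmxCK trmx_mul map_mxM /= trmxCK zZ trmx0 map_mx0.
  by rewrite -scalar_mx_block.
rewrite mul_col_mx tr_col_mx mul_col_row ZS zSZ zSz.
suff -> : Z *m S *m z^T = 0 by rewrite block_mx0.
have ST : S^T = - S by rewrite {2}Sskew opprK.
by apply: trmx_inj; rewrite !trmx_mul trmxK ST mulNmx mulmxN mulmxA zSZ oppr0 trmx0.
Qed.

Lemma unitarymx_trK n (U : 'M[C]_n) :
  U \is unitarymx -> U^T *m map_mx Num.conj U = 1%:M.
Proof.
by rewrite -trmx_unitary => /unitarymxP; rewrite trmxK.
Qed.

Lemma unitarymx_conjK n (U : 'M[C]_n) :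
  U \is unitarymx -> map_mx Num.conj U *m U^T = 1%:M.
Proof. by move=> /unitarymx_trK/mulmx1C. Qed.

(** Here det S = (-1)^n det S with det S nonzero. *)
Lemma skew_unitary_even n (S : 'M[C]_n) :
  S \is unitarymx -> S = - S^T -> ~~ odd n.
Proof.
move=> /unitarymx_unit; rewrite unitmxE unitfE => detS Sskew.
apply/negP => n_odd; have := congr1 determinant Sskew.
rewrite -scaleN1r detZ det_tr -signr_odd n_odd mulN1r => /eqP.
by rewrite -addr_eq0 -mulr2n mulrn_eq0 (negPf detS).
Qed.

(* For V = col_mx V1 V2 unitary, V^T J V = S means J V = conj(V) S, that is,
   V2 = conj(V1) S; unitarity of V then says that the rows of Z := conj(V1) are
   orthonormal and isotropic for S. *)
Lemma skew_unitary_block k (S : 'M[C]_(k + k)) :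
  S \is unitarymx -> S = - S^T ->
  exists V : 'M[C]_(k + k),
    V \is unitarymx /\ V^T *m block_mx 0 1%:M (- 1%:M) 0 *m V = S.
Proof.
move=> Su Sskew; have [|Z [Zu ZS]] := @skew_lagrangian _ S k _ Sskew.
  by rewrite addnn.
have ZSu : Z *m S \is unitarymx by rewrite mul_unitarymx.
pose V := col_mx (map_mx Num.conj Z) (Z *m S); have Vu : V \is unitarymx.
  have ZZS : map_mx Num.conj Z *m (Z *m S)^t* = 0.
    rewrite -map_mxM trmx_mul mulmxA -[Z *m S^T]opprK -mulmxN -Sskew.
    by rewrite mulNmx ZS oppr0 map_mx0.
  apply/unitarymxP; rewrite tr_col_mx map_row_mx mul_col_row ZZS.
  rewrite -[Z *m S *m _]trmxCK trmx_mul map_mxM trmxCK ZZS.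
  rewrite !(unitarymxP _) ?conjC_unitary //.
  by rewrite trmx0 map_mx0 -scalar_mx_block.
exists V; split=> //.
suff -> : V^T *m block_mx 0 1%:M (- 1%:M) 0 *m V = V^T *m map_mx Num.conj V *m S.
  by rewrite unitarymx_trK ?mul1mx.
rewrite -!mulmxA; congr (_ *m _).
rewrite mul_block_col map_col_mx mul_col_mx map_mxM -map_mx_comp.
rewrite (map_mx_id (@conjCK _)) !mul0mx !mul1mx add0r addr0 mulNmx mul1mx.
congr col_mx; rewrite -mulmxA.
(* By skewness conj(S) S = -S^* S = -1, which settles the lower block. *)
have -> : map_mx Num.conj S = - S^t* by rewrite {1}Sskew map_mxN.
by rewrite mulNmx unitarymx_adjK // mulmxN mulmx1.
Qed.

(** Generalizing the equation k + k = n and eliminating it removes the cast in [sympl_mx]. *)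
Lemma skew_unitary_sympl n (n_even : ~~ odd n) (S : 'M[C]_n) :
  S \is unitarymx -> S = - S^T ->
  exists V : 'M[C]_n, V \is unitarymx /\ V^T *m sympl_mx C n_even *m V = S.
Proof.
rewrite /sympl_mx; move: (halves_even n_even); move: n./2 => k e.
by case: _ / e S => S; rewrite castmx_id; apply: skew_unitary_block.
Qed.

(** For M with blocks a, b, c, d, the first block row of the hypothesis reads -conj(b) = c and
    conj(a) = d. *)
Lemma quaternionic_block m n (M : 'M[C]_(m + m, n + n)) :
  map_mx Num.conj M *m block_mx 0 1%:M (- 1%:M) 0 =
    block_mx 0 1%:M (- 1%:M) 0 *m M ->
  exists X Y : 'M[C]_(m, n),
    M = block_mx X Y (- map_mx Num.conj Y) (map_mx Num.conj X).
Proof.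
rewrite -[M]submxK map_block_mx !mulmx_block !(mul0mx, mulmx0, mul1mx, mulmx1).
rewrite !(mulNmx, mulmxN, mul1mx, mulmx1, add0r, addr0).
move=> /eq_block_mx[Ydl Xdr _ _].
by exists (ulsubmx M), (ursubmx M); rewrite -Ydl -Xdr.
Qed.

Lemma quaternionic_mxP m n (m_even : ~~ odd m) (n_even : ~~ odd n)
    (M : 'M[C]_(m, n)) :
  map_mx Num.conj M *m sympl_mx C n_even = sympl_mx C m_even *m M ->
  quaternionic_mx m_even n_even M.
Proof.
rewrite /sympl_mx /quaternionic_mx.
move: (halves_even m_even) (halves_even n_even); move: m./2 n./2 => k l e f.
case: _ / e M => M; case: _ / f M => M; rewrite !castmx_id.
move=> /quaternionic_block[X [Y XY]].
by exists X, Y; rewrite castmx_id.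
Qed.

End UnitaryMatrices.

(** * Endomorphisms and isometries of representations *)

Section Representations.
Variables (C : numClosedFieldType) (p : nat) (Q : quiver p) (d : 'I_p -> nat).
Implicit Types (A B : urep C Q d) (S T U N : forall i, 'M[C]_(d i)).

Lemma indecomposable_vertex A : indecomposable A -> exists i, (0 < d i)%N.
Proof.
move=> [d_neq0 _]; have [/existsP//|/existsPn no_i] := boolP [exists i, 0 < d i]%N.
by case: d_neq0 => i; apply/eqP; rewrite -leqn0 leqNgt no_i.
Qed.

(** A form of Schur's lemma: normality makes eigenspaces orthogonal, so splitting them is an
    isometry. *)
Lemma indecomposable_normal_endo A N : indecomposable A ->
  (forall i, N i \is normalmx) ->
  (forall a, N (target a) *m A a = A a *m N (source a)) ->
  exists l : C, forall i, N i = l%:M.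
Proof.
move=> A_ind N_normal NA.
pose P i := spectralmx (N i); pose D i := spectral_diag (N i).
have Pu i : P i \is unitarymx by apply: spectral_unitarymx.
have PU i := unitarymx_unit (Pu i).
have N_eq i : N i = invmx (P i) *m diag_mx (D i) *m P i.
  by apply/orthomx_spectralP.
(* In eigenbases [N] is diagonal, so [A'] vanishes between coordinates with different
   eigenvalues. *)
pose A' a := P (target a) *m A a *m invmx (P (source a)).
have DA' a : diag_mx (D (target a)) *m A' a = A' a *m diag_mx (D (source a)).
  have PN i : diag_mx (D i) *m P i = P i *m N i.
    by rewrite N_eq !mulmxA mulmxV ?mul1mx.
  have NP i : N i *m invmx (P i) = invmx (P i) *m diag_mx (D i).
    by rewrite N_eq mulmxK.
  rewrite /A' !mulmxA PN -[P _ *m N _ *m A a]mulmxA NA.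
  by rewrite !mulmxA -[_ *m N _ *m _]mulmxA NP mulmxA.
have [i0 d_i0] := indecomposable_vertex A_ind.
(* Taking [l] at a vertex of positive dimension makes the first summand nonzero. *)
pose k0 := Ordinal d_i0; pose l := D i0 0 k0.
pose E i := [set k | D i 0 k == l].
pose f i (k : 'I_#|E i|) := enum_val k.
pose g i (k : 'I_#|~: E i|) := enum_val k.
have fE i k : D i 0 (f i k) = l by have := enum_valP k; rewrite inE => /eqP.
have gE i k : D i 0 (g i k) != l by have := enum_valP k; rewrite !inE.
(* The rows of [P i] are reordered, those with eigenvalue [l] first. *)
pose S i := col_mx (rowsub (@f i) (P i)) (rowsub (@g i) (P i)).
have dE i : d i = (#|E i| + #|~: E i|)%N by rewrite cardsC card_ord.
have Su i : S i \is unitarymx.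
  have offdiag q r (u : 'I_q -> 'I_(d i)) (v : 'I_r -> 'I_(d i)) :
      (forall x y, u x != v y) -> mxsub u v (1%:M : 'M[C]_(d i)) = 0.
    by move=> uv; apply/matrixP => x y; rewrite !mxE (negPf (uv x y)).
  apply/unitarymxP; rewrite tr_col_mx map_row_mx mul_col_row !adj_rowsub !mxsub_mul.
  rewrite (unitarymxP _) // !mxsub1_inj; try exact: enum_val_inj.
  rewrite !offdiag -?scalar_mx_block // => x y.
    by apply: contraTneq (gE i x) => ->; rewrite fE eqxx.
  by apply: contraTneq (gE i y) => <-; rewrite fE eqxx.
pose A1 : urep C Q (fun i => #|E i|) :=
  fun a => mxsub (@f (target a)) (@f (source a)) (A' a).
pose A2 : urep C Q (fun i => #|~: E i|) :=
  fun a => mxsub (@g (target a)) (@g (source a)) (A' a).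
have SA : urep_isometric A (dsum_urep A1 A2).
  exists S; split=> // a.
  (* Inserting S^* S = 1 reduces the claim to S A S^* being block diagonal; its blocks are
     submatrices of [A']. *)
  rewrite -[LHS]mulmx1 -(unitarymx_adjK (esym (dE (source a))) (Su _)) mulmxA.
  congr (_ *m _); rewrite /dsum_urep /S tr_col_mx map_row_mx mul_col_mx mul_col_row.
  rewrite !adj_rowsub.
  have rowsubA q (u : 'I_q -> 'I_(d (target a))) :
      rowsub u (P (target a)) *m A a = rowsub u (P (target a) *m A a).
    by rewrite -[X in _ *m X](mxsub_id _) mxsub_mul.
  rewrite !rowsubA !mxsub_mul -invmx_unitary // -/(A' a).
  congr block_mx; apply/matrixP => x y; rewrite [LHS]mxE [RHS]mxE.
    by apply: (diag_mx_intertwine (DA' a)); rewrite fE eq_sym.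
  by apply: (diag_mx_intertwine (DA' a)); rewrite fE.
have [/(_ i0)/eqP|all_l] := A_ind.2 _ _ _ _ SA.
  by rewrite cards_eq0 => /eqP/setP/(_ k0); rewrite !inE eqxx.
exists l => i; have -> : N i = invmx (P i) *m l%:M *m P i.
  rewrite N_eq -diag_const_mx; congr (_ *m diag_mx _ *m _); apply/rowP => k.
  rewrite [RHS]mxE; apply/eqP; apply: contraTT isT => Dk.
  by have /eqP := all_l i; rewrite cards_eq0 => /eqP/setP/(_ k); rewrite !inE Dk.
by rewrite -mulmxA -scalar_mxC mulmxA mulVmx ?mul1mx.
Qed.

Lemma isometry_comp A B B' S T : urep_isometry A B S -> urep_isometry B B' T ->
  urep_isometry A B' (fun i => T i *m S i).
Proof.
move=> [_ Su SA] [_ Tu TB]; split=> // [i|a]; first by rewrite mul_unitarymx.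
by rewrite -mulmxA SA mulmxA TB mulmxA.
Qed.

Lemma isometry_adj A B S :
  urep_isometry A B S -> urep_isometry B A (fun i => (S i)^t*).
Proof.
move=> [_ Su SA]; split=> // [i|a]; first by rewrite trmxC_unitary.
rewrite -[LHS](mulmxtVK _ (Su (source a))) -[_ *m B a *m _]mulmxA -SA.
by rewrite mulmxA unitarymx_adjK // mul1mx.
Qed.

Lemma isometry_conj A B S : urep_isometry A B S ->
  urep_isometry (conj_urep A) (conj_urep B) (fun i => map_mx Num.conj (S i)).
Proof.
move=> [_ Su SA]; split=> // [i|a]; first by rewrite conjC_unitary.
by rewrite -!map_mxM SA.
Qed.

Lemma isometry_transport A U :
  (forall i, U i \is unitarymx) -> urep_isometry A (transport U A) U.
Proof. by move=> Uu; split=> // a; rewrite mulmxKV ?unitarymx_unit. Qed.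

Lemma euclideanP A : euclidean A <-> forall a, map_mx Num.conj (A a) = A a.
Proof.
split=> A_real a; last by apply/mxOverP => i j; apply/CrealP; rewrite -{2}A_real mxE.
by apply/matrixP => i j; rewrite mxE; apply/CrealP; have /mxOverP := A_real a.
Qed.

(** Compose U : A -> B = conj(B) with the inverse of conj(U), which is U^T. *)
Lemma euclidean_isometry_sym A B U : euclidean B -> urep_isometry A B U ->
  urep_isometry A (conj_urep A) (fun i => (U i)^T *m U i).
Proof.
move=> /euclideanP B_real UA; have := isometry_adj (isometry_conj UA).
move=> /= [_ Uu UB]; apply: (isometry_comp UA); split=> // [i|a].
  by rewrite trmx_unitary; case: UA.
have := UB a; rewrite /conj_urep B_real -!map_trmx -!map_mx_comp.
by rewrite !(map_mx_id (@conjCK _)).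
Qed.

(** T^* S is a unitary, hence normal, endomorphism of A. *)
Lemma indecomposable_isometry_scale A B S T : indecomposable A ->
  urep_isometry A B S -> urep_isometry A B T ->
  exists l : C, forall i, S i = l *: T i.
Proof.
move=> A_ind SA TA; have [_ Nu NA] := isometry_comp SA (isometry_adj TA).
have [i|l Nl] :=
  indecomposable_normal_endo (N := fun i => (T i)^t* *m S i) A_ind _ NA.
  exact: unitarymx_normal.
exists l => i; have [_ /(_ i) Tu _] := TA.
by rewrite -mul_mx_scalar -Nl mulmxA (unitarymxP _) ?mul1mx.
Qed.

Lemma conj_isometry_sym_or_skew A S : indecomposable A ->
  urep_isometry A (conj_urep A) S ->
  (forall i, S i = (S i)^T) \/ (forall i, S i = - (S i)^T).
Proof.
move=> A_ind SA; have := isometry_adj (isometry_conj SA).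
(* The inverse of conj(S) is S^T. It starts at A conjugated twice, which is A only pointwise, so the
   isometry is rebuilt. *)
move=> [_ _ STA]; have {STA}TA : urep_isometry A (conj_urep A) (fun i => (S i)^T).
  have [_ Su _] := SA; split=> // [i|a]; first by rewrite trmx_unitary.
  have := STA a; rewrite /conj_urep -!map_trmx -!map_mx_comp.
  by rewrite !(map_mx_id (@conjCK _)).
have [l Sl] := indecomposable_isometry_scale A_ind SA TA.
have [i0 d_i0] := indecomposable_vertex A_ind.
have : l ^+ 2 == 1.
  have S_unit : S i0 \in unitmx by have [_ Su _] := SA; apply: unitarymx_unit.
  have Sll : S i0 = l ^+ 2 *: S i0.
    have ST : (S i0)^T = l *: S i0.
      by apply: trmx_inj; rewrite trmxK linearZ /= -Sl.
    by rewrite {1}Sl ST scalerA expr2.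
  have := congr1 (mulmx^~ (invmx (S i0))) Sll; rewrite -scalemxAl mulmxV //.
  pose k0 := Ordinal d_i0 => /matrixP/(_ k0 k0).
  by rewrite !mxE eqxx mulr1 => /eqP; rewrite eq_sym.
rewrite sqrf_eq1 => /orP[]/eqP l1; [left|right] => i; rewrite [LHS]Sl l1.
  by rewrite scale1r.
by rewrite scaleN1r.
Qed.

Lemma transport_intertwine A S (J U : forall i, 'M[C]_(d i)) :
  urep_isometry A (conj_urep A) S -> (forall i, U i \is unitarymx) ->
  (forall i, (U i)^T *m J i *m U i = S i) ->
  forall a, map_mx Num.conj (transport U A a) *m J (source a) =
    J (target a) *m transport U A a.
Proof.
move=> [_ _ SA] Uu US a; have UU i := unitarymx_unit (Uu i).
have cUS i : map_mx Num.conj (U i) *m S i = J i *m U i.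
  by rewrite -US !mulmxA unitarymx_conjK ?mul1mx.
have [_ _ /(_ a) TA] := isometry_transport A Uu.
have [_ _ /(_ a) cTA] := isometry_conj (isometry_transport A Uu).
(* After multiplication by U, with C = U A U^-1: conj(C) J U = conj(C) conj(U) S = conj(U) conj(A) S
   = conj(U) S A = J U A = J C U. *)
apply: (can_inj (mulmxK (UU (source a)))).
rewrite -[LHS]mulmxA -cUS mulmxA -[X in X *m _]cTA -[LHS]mulmxA -SA mulmxA cUS.
by rewrite -[LHS]mulmxA TA mulmxA.
Qed.

End Representations.

Theorem theorem4p2 (R : realType) (p : nat) (Q : quiver p) (d : 'I_p -> nat)
    (A : urep R[i] Q d) :
  (~ urep_isometric A (conj_urep A) -> ~ isometric_to_euclidean A)
  /\
  (indecomposable A ->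
   forall S : (forall i, 'M[R[i]]_(d i)), urep_isometry A (conj_urep A) S ->
   ((forall i, S i = (S i)^T) ->
      (exists U : forall i, 'M[R[i]]_(d i),
         forall i, U i \is unitarymx /\ (U i)^T *m U i = S i)
      /\
      (forall U : (forall i, 'M[R[i]]_(d i)),
         (forall i, U i \is unitarymx /\ (U i)^T *m U i = S i) ->
         euclidean (transport U A) /\ urep_isometry A (transport U A) U))
   /\
   (~ (forall i, S i = (S i)^T) ->
      (forall i, S i = - (S i)^T)
      /\ ~ isometric_to_euclidean A
      /\ exists d_even : forall i, ~~ odd (d i),
         (exists V : forall i, 'M[R[i]]_(d i),
            forall i, V i \is unitarymx
              /\ (V i)^T *m sympl_mx R[i] (d_even i) *m V i = S i)
         /\
         (forall V : (forall i, 'M[R[i]]_(d i)),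
            (forall i, V i \is unitarymx
              /\ (V i)^T *m sympl_mx R[i] (d_even i) *m V i = S i) ->
            (forall a, quaternionic_mx (d_even (target a)) (d_even (source a))
                         (transport V A a))
            /\ urep_isometry A (transport V A) V))).
Proof.
have not_euclid : ~ urep_isometric A (conj_urep A) -> ~ isometric_to_euclidean A.
  move=> A_conj [B [B_real [U UA]]]; apply: A_conj.
  by exists (fun i => (U i)^T *m U i); apply: euclidean_isometry_sym UA.
split=> // A_ind S SA; have [_ Su _] := SA.
split=> [S_sym|S_nsym].
  split=> [|U US].
    have /fin_all_exists[U US] i := takagi_unitary (Su i) (S_sym i).
    by exists U.
  have Uu i : U i \is unitarymx by have [] := US i.
  split; last exact: isometry_transport.
  apply/euclideanP => a.
  have := transport_intertwine (J := fun i => 1%:M) SA Uu _ a.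
  rewrite mulmx1 mul1mx; apply=> i.
  by rewrite mulmx1; have [] := US i.
have S_skew : forall i, S i = - (S i)^T.
  by have [] := conj_isometry_sym_or_skew A_ind SA.
split=> //; split.
  move=> [B [B_real [U UA]]]; apply: S_nsym => i.
  have [l ->] := indecomposable_isometry_scale A_ind SA (euclidean_isometry_sym B_real UA).
  by rewrite linearZ /= trmx_mul trmxK.
(* [S i] is invertible and skew-symmetric, which forces even size at every vertex. *)
pose d_even i := skew_unitary_even (Su i) (S_skew i); exists d_even.
split=> [|V VS].
  exact: fin_all_exists (fun i => skew_unitary_sympl _ (Su i) (S_skew i)).
have Vu i : V i \is unitarymx by have [] := VS i.
split=> [a|]; last exact: isometry_transport.
apply: quaternionic_mxP.
apply: (transport_intertwine (J := fun i => sympl_mx _ (d_even i)) SA Vu) => i.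
by have [] := VS i.
Qed.
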